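(* Let $Y\in\mathbb{R}$ and let $(s,p,\Gamma)$ be the unique solution (in the sense defined in the context) to the free boundary problem \[ \begin{array}{lll} (1)& \dfrac{\partial^2 p}{\partial x^2}(x,t) = 2Y\,(1-\Gamma(x,t)), & 0<x<s(t),\ t>0,\\[2mm] (2)& -\dfrac{\partial p}{\partial x}(s(t),t) = 2\phi\, s'(t), & t>0,\\[2mm] (3)& \dfrac{\partial \Gamma}{\partial t}(x,t) = 1-\Gamma(x,t), & 0<x<s(t),\ t>0,\\[2mm] (4)& p(0,t)=1,\quad p(s(t),t)=0, & t>0,\\ (5)& \Gamma(s(t),t)=0, & t>0,\\ (6)& s(0)=0. & \end{array} \] (i) If $\phi>0$, then \[ \lim_{t\to 0^+}\frac{s(t)}{\sqrt{t/\phi}}=1 . \] (ii) If $\phi>0$ and $\phi+Y>0$, then \[ \lim_{t\to\infty}\frac{s(t)}{\sqrt{t/(\phi+Y)}}=1 . \]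
   Context: This is a dimensionless one-dimensional model of water infiltration coupled with a hydration reaction: $s(t)$ is the position of the infiltration front, $p$ the pressure, $\Gamma$ the extent of the reaction, $\phi$ the porosity, and $Y$ the volume of water consumed by the reaction per unit volume of medium. A (global-in-time) solution is a triple $(s,p,\Gamma)$ satisfying (1)–(6), where: - $s:[0,\infty)\to[0,\infty)$ is continuous on $[0,\infty)$ and $C^1$ on $(0,\infty)$; - with $Q=\{(x,t): 0\le x\le s(t),\ t>0\}$, $p\in C(Q)$ and $p(\cdot,t)\in C^2((0,s(t)))$ for every $t>0$; the derivative $\frac{\partial p}{\partial x}(s(t),t)$ in (2) is the one-sided one, i.e. the limit of $\frac{\partial p}{\partial x}(x,t)$ as $x\to s(t)^-$; - $\Gamma$ is a bounded measurable function on $Q$ (functions differing only on the set $\{x=0\}$ are identified). For $x>0$ with $x<s(t)$ for some $t$, let $h(x)=\inf\{t>0: s(t)>x\}$ be the arrival time of the front at $x$. For every such $x$ one requires that $(x,t)\in Q$ for all $t\ge h(x)$, that $\Gamma(x,\cdot)$ is $C^1$ on $(h(x),\infty)$, and that $\Gamma(x,\cdot)$ is continuous on $[h(x),\infty)$, so that (5) acts as an initial condition for (3). For every $\phi>0$ and $Y\in\mathbb{R}$ such a solution exists and is unique. *)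

(* Defs.v *)
From HB Require Import structures.
From mathcomp Require Import all_boot all_order all_algebra.
From mathcomp Require Import all_classical all_reals all_analysis.
From mathcomp Require Import measurable_realfun.

Set Implicit Arguments.
Unset Strict Implicit.
Unset Printing Implicit Defensive.

Import Order.TTheory GRing.Theory Num.Theory.
Import numFieldNormedType.Exports.

Local Open Scope classical_set_scope.
Local Open Scope ring_scope.

(* Only used on open sets A, where derive1 f depends on the restriction of f
   to A alone. *)
Definition C1_on (R : realType) (A : set R) (f : R -> R) : Prop :=
  (forall x, A x -> derivable f x 1) /\ {within A, continuous (derive1 f)}.

Definition C2_on (R : realType) (A : set R) (f : R -> R) : Prop :=
  C1_on A f /\ C1_on A (derive1 f).

(* The Lebesgue measurable structure of the plane: the completion of the Borel
   sigma-algebra for the product measure. *)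
Definition lebesgue_plane (R : realType) :=
  g_sigma_algebraType (completed_algebra_gen
    ((@lebesgue_measure R) \x (@lebesgue_measure R))%E).

(* Points are pairs (x, t): position first, time second. *)
Definition wet_region (R : realType) (s : R -> R) : set (R * R) :=
  [set z | 0 <= z.1 <= s z.2 /\ 0 < z.2].

Definition arrival_time (R : realType) (s : R -> R) (x : R) : R :=
  inf [set t : R | 0 < t /\ x < s t].

(* The functions s, p, Gamma are total, but no condition below depends on
   the values of s at negative times or of p x t and Gamma x t for (x, t)
   outside of wet_region s. *)
Record is_solution (R : realType) (phi Y : R)
    (s : R -> R) (p Gamma : R -> R -> R) : Prop := {
  s_ge0 : forall t : R, 0 <= t -> 0 <= s t ;
  s_continuous : {within `[0, +oo[%classic, continuous s} ;
  s_C1 : C1_on `]0, +oo[%classic s ;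

  p_continuous :
    {within wet_region s, continuous (fun z : R * R => p z.1 z.2)} ;
  p_C2 : forall t : R, 0 < t -> C2_on `]0, s t[%classic (p ^~ t) ;

  Gamma_bounded :
    [bounded Gamma z.1 z.2 | z in wet_region s] ;
  Gamma_measurable :
    measurable_fun (wet_region s : set (lebesgue_plane R))
      (fun z : lebesgue_plane R => Gamma z.1 z.2) ;
  Gamma_regular : forall x : R, 0 < x -> (exists2 t : R, 0 <= t & x < s t) ->
    [/\ forall t : R, arrival_time s x <= t -> wet_region s (x, t),
        C1_on `]arrival_time s x, +oo[%classic (Gamma x) &
        {within `[arrival_time s x, +oo[%classic, continuous (Gamma x)}] ;

  pressure_eq : forall x t : R, 0 < t -> 0 < x < s t ->
    derive1 (derive1 (p ^~ t)) x = 2 * Y * (1 - Gamma x t) ;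
  (* The derivative of p in x at the front is the limit of the interior
     derivatives from the left. *)
  front_eq : forall t : R, 0 < t ->
    (- derive1 (p ^~ t) x) @[x --> (s t)^'-] --> 2 * phi * derive1 s t ;
  reaction_eq : forall x t : R, 0 < t -> 0 < x < s t ->
    derive1 (Gamma x) t = 1 - Gamma x t ;
  pressure_inlet : forall t : R, 0 < t -> p 0 t = 1 ;
  pressure_front : forall t : R, 0 < t -> p (s t) t = 0 ;
  reaction_front : forall t : R, 0 < t -> Gamma (s t) t = 0 ;
  s_initial : s 0 = 0
}.

(* Main.v *)
(** Integrating the reaction law gives [1 - Gamma x t = expR (h x - t)] with [h]
    the arrival time, so [g t x = x * p_x - p] satisfies
    [g_x = 2 Y x expR (h x - t)], with [g t x --> -1] at the inlet and
    [g t x --> V t - 1] at the front, where [V = 1 - phi * u'] and [u = s ^ 2].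
    Hence [expR b * g b - expR a * g a] is constant in [x] on the region wet at
    time [a < b], and the increment of [expR * V] from [a] to [b] only sees the
    layer between [s a] and [s b], where [h] lies in [[a, b]]. This yields
    [(expR * V)' = Y * expR * u'] without any integral or change of variables.
    Near [0], [`|V| <= `|Y| * u] forces [phi * u'] to tend to [1]. At infinity,
    the linear equation [phi * V' = Y - (phi + Y) * V] keeps [V] bounded, while
    [(phi + Y) * u - t - V] is constant. *)

Require Import Defs.
From HB Require Import structures.
From mathcomp Require Import all_boot all_order all_algebra.
From mathcomp Require Import all_classical all_reals all_analysis.
From mathcomp Require Import ring lra.

Import Order.TTheory GRing.Theory Num.Theory.
Import numFieldNormedType.Exports.

Local Open Scope classical_set_scope.
Local Open Scope ring_scope.

(** * Mean value estimates in place of integration *)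

Lemma increment_le {R : realType} {f k df dk : R -> R} {a b : R} :
  a <= b ->
  (forall x, a <= x <= b -> is_derive x 1 f (df x)) ->
  (forall x, a <= x <= b -> is_derive x 1 k (dk x)) ->
  (forall x, a < x < b -> `|df x| <= dk x) ->
  `|f b - f a| <= k b - k a.
Proof.
move=> + Df Dk dfk; rewrite le_eqVlt => /predU1P[->|ab].
  by rewrite !subrr normr0.
have mono (h dh : R -> R) : (forall x, a <= x <= b -> is_derive x 1 h (dh x)) ->
    (forall x, a < x < b -> 0 <= dh x) -> h a <= h b.
  move=> Dh dh0.
  have [x xab|x|c] := @MVT _ h dh a b ab.
  - by apply: Dh; move: xab; rewrite in_itv/= => /andP[/ltW -> /ltW ->].
  - apply: derivable_within_continuous => y; rewrite in_itv/= => yab.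
    exact: (@ex_derive _ _ _ _ _ _ _ (Dh y yab)).
  - rewrite in_itv/= => cab hba; rewrite -subr_ge0 hba mulr_ge0 ?dh0//.
    by rewrite subr_ge0 ltW.
rewrite ler_norml; apply/andP; split.
- suff : k a + f a <= k b + f b by lra.
  apply: (mono (k + f) (fun x => dk x + df x)) => x xab.
    exact: is_deriveD (Dk x xab) (Df x xab).
  by have := dfk x xab; rewrite ler_norml => /andP[? ?]; lra.
- suff : k a - f a <= k b - f b by lra.
  apply: (mono (k - f) (fun x => dk x - df x)) => x xab.
    exact: is_deriveB (Dk x xab) (Df x xab).
  by have := dfk x xab; rewrite ler_norml => /andP[? ?]; lra.
Qed.

Lemma is_derive0_cst {R : realType} {f : R -> R} {a b : R} : a <= b ->
  (forall x, a <= x <= b -> is_derive x 1 f 0) -> f b = f a.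
Proof.
move=> ab Df.
have : `|f b - f a| <= cst 0 b - cst 0 a.
  apply: (increment_le ab Df (fun x _ => is_derive_cst 0 x 1)) => x _.
  by rewrite normr0.
by rewrite [leRHS]subrr normr_le0 subr_eq0 => /eqP.
Qed.

Lemma is_derive_scale_sqr {R : realType} (c z : R) :
  is_derive z 1 (fun z : R => c * z ^+ 2) (c * (2 * z)).
Proof.
have -> : c * (2 * z) = c *: (z *: 1 + z *: 1) by rewrite /GRing.scale/=; ring.
exact: (@is_deriveZ _ _ _ _ c z 1 _
  (is_deriveM (is_derive_id z (1 : R)) (is_derive_id z (1 : R)))).
Qed.

Lemma is_derive_expR_scale {R : realType} (c z : R) :
  is_derive z 1 (fun z : R => expR (c * z)) (c * expR (c * z)).
Proof.
have D : is_derive z 1 (fun z : R => c * z) c.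
  rewrite -[X in is_derive _ _ _ X]mulr1.
  exact: (@is_deriveZ _ _ _ id c z 1 1 (is_derive_id z 1)).
by rewrite mulrC; exact: (@is_derive1_comp _ expR _ z _ _ (is_derive_expR (c * z)) D).
Qed.

(** Dividing the bound by [r - t] leaves the difference quotient of [k], which is bounded, times
    [e r - e t], which vanishes. Only continuity of [e] is used, so [f] is differentiated through
    its increments relative to those of [k]. It serves with [k] the squared front and [e] the
    exponential. *)
Lemma is_derive_squeeze {R : realType} {f k e : R -> R} {c C dk t : R} :
  is_derive t 1 k dk -> e r @[r --> t] --> e t ->
  (\forall r \near t,
    `|f r - f t - c * (k r - k t)| <= C * `|k r - k t| * `|e r - e t|) ->
  is_derive t 1 f (c * dk).
Proof.
move=> Dk ec near_le.
pose q (F : R -> R) (d : R) := d^-1 * (F (d + t) - F t).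
have qE F : (fun d => d^-1 *: ((F \o shift t) (d *: 1) - F t)) = q F.
  by apply/funext => d; rewrite /q /GRing.scale/= mulr1.
have qk : q k d @[d --> 0^'] --> dk.
  have dkt : derivable k t 1 by exact: ex_derive.
  rewrite -[X in _ --> X](@derive_val _ _ _ _ _ _ _ Dk).
  by move: dkt; rewrite /derivable /derive qE.
have sh : d + t @[d --> (0 : R)^'] --> t.
  rewrite -[X in _ --> X]add0r; apply: cvgD; last exact: cvg_cst.
  by apply: cvg_within_filter; exact: cvg_id.
have qr : (q f d - c * q k d) @[d --> 0^'] --> (0 : R).
  apply/norm_cvg0P.
  have bnd : (C * `|q k d| * `|e (d + t) - e t|) @[d --> 0^'] --> (0 : R).
    rewrite -[X in _ --> X](mulr0 (C * `|dk|)); apply: cvgM.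
      by apply: cvgM; [exact: cvg_cst|exact: cvg_norm].
    apply/norm_cvg0P; rewrite -[X in _ --> X](subrr (e t)).
    by apply: cvgB; [exact: cvg_comp sh ec|exact: cvg_cst].
  apply: squeeze_cvgr (cvg_cst _) bnd; near=> d; rewrite normr_ge0/=.
  rewrite /q mulrCA -mulrBr !normrM mulrCA -!mulrA ler_wpM2l//.
  by rewrite mulrA; near: d; exact: sh near_le.
have qf : q f d @[d --> 0^'] --> c * dk.
  rewrite -[X in _ --> X]add0r.
  apply: cvg_trans (cvgD qr (cvgM (cvg_cst c) qk)); apply: near_eq_cvg.
  by apply: nearW => d; rewrite addrfctE/= subrK.
apply: DeriveDef.
  by rewrite /derivable qE; apply/cvg_ex; exists (c * dk).
by rewrite /derive qE; exact: cvg_lim qf.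
Unshelve. all: by end_near. Qed.

(** * The front, its arrival times and the extent of the reaction *)

Section solution.
Context {R : realType} {phi Y : R} {s : R -> R} {p Gamma : R -> R -> R}.
Hypothesis sol : is_solution phi Y s p Gamma.

Let h := arrival_time s.

(** If the front were at the inlet, the two boundary values of the pressure, 1 and 0, would be taken
    at the same point. *)
Lemma front_gt0 {t : R} : 0 < t -> 0 < s t.
Proof.
move=> t0; rewrite lt_neqAle (s_ge0 sol) ?ltW// andbT; apply/eqP => st0.
have := pressure_inlet sol t0; rewrite st0 (pressure_front sol) ?t0//.
by move/eqP; rewrite eq_sym oner_eq0.
Qed.

Lemma arrival_set_lbound (x : R) :
  has_lbound [set t : R | 0 < t /\ x < s t].
Proof. by exists 0 => t [/ltW]. Qed.

Lemma arrival_le {x t : R} : 0 < t -> x < s t -> h x <= t.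
Proof. by move=> t0 xt; apply: ge_inf => //; exact: arrival_set_lbound. Qed.

Lemma arrival_wet {x t r : R} :
  0 < x -> 0 < t -> x < s t -> h x <= r -> 0 < r /\ x <= s r.
Proof.
move=> x0 t0 xt hr.
have [|+ _ _] := Gamma_regular sol x0; first by exists t => //; rewrite ltW.
by move=> /(_ r hr)[/= /andP[_ ->] ->].
Qed.

(** A point once passed by the front stays wet. If the front receded, the midpoint of [s b] and
    [s a] would be wet at time [a] and dry at the later time [b]. *)
Lemma front_nondecreasing {a b : R} : 0 <= a -> a <= b -> s a <= s b.
Proof.
rewrite le_eqVlt => /predU1P[<- b0|a0 ab].
  by rewrite (s_initial sol) (s_ge0 sol).
rewrite leNgt; apply/negP => sba.
have sb0 := s_ge0 sol (le_trans (ltW a0) ab).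
pose x := (s a + s b) / 2.
have xa : x < s a by rewrite /x; lra.
have x0 : 0 < x by rewrite /x; lra.
have [_] := arrival_wet x0 a0 xa (le_trans (arrival_le a0 xa) ab).
by rewrite /x; lra.
Qed.

Lemma lt_arrival {x t r : R} : 0 < t -> x < s t -> h x < r -> x < s r.
Proof.
move=> t0 xt hr.
have hi : has_inf [set t : R | 0 < t /\ x < s t].
  by split; [exists t | exact: arrival_set_lbound].
have [|q /= [q0 xq]] := @inf_adherent _ _ (r - h x) _ hi.
  by rewrite subr_gt0.
rewrite -/(arrival_time s x) -/(h x) subrKC => qr.
by apply: lt_le_trans xq (front_nondecreasing (ltW q0) (ltW qr)).
Qed.

Lemma le_arrival {x a t : R} : 0 < t -> x < s t -> s a <= x -> a <= h x.
Proof.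
move=> t0 xt sax; apply: lb_le_inf; first by exists t.
move=> r [/= r0 xr]; rewrite leNgt; apply/negP => ra.
have := front_nondecreasing (ltW r0) (ltW ra); rewrite leNgt => /negP; apply.
exact: le_lt_trans sax xr.
Qed.

Lemma front_derive {t : R} : 0 < t -> is_derive t 1 s (derive1 s t).
Proof.
move=> t0; rewrite derive1E; apply/derivableP.
by have [+ _] := s_C1 sol; apply; rewrite /= in_itv/= t0.
Qed.

Lemma front_cvg {t : R} : 0 < t -> s r @[r --> t] --> s t.
Proof.
move=> /front_derive ?; apply: differentiable_continuous.
by rewrite -derivable1_diffP.
Qed.

(** If the front were already beyond [x] at the positive time [h x], continuity would put it beyond
    [x] slightly earlier, against the choice of [h x] as an infimum. *)
Lemma front_arrival {x t : R} : 0 < x -> 0 < t -> x < s t -> s (h x) = x.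
Proof.
move=> x0 t0 xt; have [h0 hx] := arrival_wet x0 t0 xt (lexx _).
apply/eqP; rewrite eq_le hx andbT leNgt; apply/negP => xh.
have : \forall r \near h x, 0 < r /\ x < s r.
  near=> r; split; near: r; first exact: lt_nbhsr.
  by apply: (cvgr_gt _ (front_cvg h0)).
move=> /nbhs_ballP[e /= e0] /(_ (h x - e / 2))[].
  rewrite /ball/= opprB addrC subrK gtr0_norm ?divr_gt0//.
  by rewrite ltr_pdivrMr// ltr_pMr// ltr1n.
move=> r0 xr; have := arrival_le r0 xr.
by rewrite leNgt => /negP; apply; rewrite ltrBlDr ltrDl divr_gt0.
Unshelve. all: by end_near. Qed.

(** The product [(1 - Gamma x r) * expR r] has zero derivative after arrival. Its limit at arrival
    is [expR (h x)], because the front then sits exactly at [x] and [Gamma] vanishes there. *)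
Lemma reaction_extent {x t : R} : 0 < t -> 0 < x < s t ->
  1 - Gamma x t = expR (h x - t).
Proof.
move=> t0 /andP[x0 xt]; have [h0 _] := arrival_wet x0 t0 xt (lexx _).
have sh := front_arrival x0 t0 xt.
have ht : h x < t.
  rewrite lt_neqAle (arrival_le t0 xt) andbT; apply/eqP => ht.
  by move: xt; rewrite -ht sh ltxx.
have [|_ [GD _] Gc] := Gamma_regular sol x0; first by exists t => //; rewrite ltW.
have DG r : h x < r -> is_derive r 1 (Gamma x) (1 - Gamma x r).
  move=> hr; rewrite -(reaction_eq sol) ?(lt_trans h0 hr)//; last first.
    by rewrite x0 (lt_arrival t0 xt).
  by rewrite derive1E; apply/derivableP/GD; rewrite /= in_itv/= hr.
pose F r := (1 - Gamma x r) * expR r.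
have DF r : h x < r -> is_derive r 1 F 0.
  move=> /DG D.
  have -> : (0 : R) = (1 - Gamma x r) *: expR r + expR r *: (0 - (1 - Gamma x r)).
    by rewrite /GRing.scale/=; ring.
  by apply: is_deriveM; apply: is_deriveB.
have Fc : F r @[r --> (h x)^'+] --> expR (h x).
  have Gh : Gamma x (h x) = 0 by rewrite -{1}sh (reaction_front sol).
  have -> : expR (h x) = (1 - Gamma x (h x)) * expR (h x).
    by rewrite Gh subr0 mul1r.
  apply: cvgM; last by apply: cvg_at_right_filter; exact: continuous_expR.
  apply: cvgB; first exact: cvg_cst.
  by have /continuous_within_itvcyP[] := Gc.
have Fh : F t = expR (h x).
  apply: (@cvg_unique _ _ (F r @[r --> (h x)^'+])) => //.
  apply: cvg_near_cst; near=> r.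
  apply/esym/is_derive0_cst; first by near: r; exact: nbhs_right_ltW.
  move=> q /andP[rq _]; apply: DF; apply: lt_le_trans rq.
  by near: r; exact: nbhs_right_gt.
by rewrite expRB -Fh /F mulfK// gt_eqF// expR_gt0.
Unshelve. all: by end_near. Qed.

(** * The pressure and the flux [g] as functions of position *)

Lemma pressure_within {t : R} : 0 < t ->
  {within `[0, s t], continuous (p ^~ t)}.
Proof.
move=> t0; apply/subspace_continuousP => y; rewrite /= in_itv/= => yst.
have /subspace_continuousP/(_ (y, t)) := p_continuous sol.
move=> /(_ (conj yst t0)) pc.
apply: (@cvg_comp _ _ _ (fun x => (x, t)) (fun z => p z.1 z.2) _ _ _ _ pc).
move=> U wU.
have pr : (x, t) @[x --> (y : R)] --> ((y : R), t).
  apply: (@cvg_pair R R R (nbhs (y : R)) (nbhs (y : R)) (nbhs t) _ _ _ id (cst t)).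
    exact: cvg_id.
  exact: cvg_cst.
have := pr [set z | wet_region s z -> U z] wU.
move=> wV; suff : \forall x \near (y : R), `[0, s t]%classic x -> U (x, t) by [].
near=> x => xst; suff : wet_region s (x, t) -> U (x, t).
  by apply; split => //=; move: xst; rewrite /= in_itv.
by near: x.
Unshelve. all: by end_near. Qed.

Lemma pressure_derive {t x : R} : 0 < t -> 0 < x < s t ->
  is_derive x 1 (p ^~ t) (derive1 (p ^~ t) x).
Proof.
move=> t0 xt; rewrite derive1E; apply/derivableP.
by have [[+ _] _] := p_C2 sol t0; apply; rewrite /= in_itv.
Qed.

Lemma pressure_derive2 {t x : R} : 0 < t -> 0 < x < s t ->
  is_derive x 1 (derive1 (p ^~ t)) (2 * Y * expR (h x - t)).
Proof.
move=> t0 xt; rewrite -reaction_extent// -(pressure_eq sol)//.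
rewrite [X in is_derive _ _ _ X]derive1E.
by apply/derivableP; have [_ [+ _]] := p_C2 sol t0; apply; rewrite /= in_itv.
Qed.

(** An antiderivative in [x] of [x * p_xx]. The weight [x] removes the unknown slope of the pressure
    at the inlet, and at the front it turns [s'] into [s * s'], half the derivative of [s ^ 2]. *)
Let g (t x : R) := x * derive1 (p ^~ t) x - p x t.

Lemma flux_derive {t x : R} : 0 < t -> 0 < x < s t ->
  is_derive x 1 (g t) (2 * Y * x * expR (h x - t)).
Proof.
move=> t0 xt.
have D1 := pressure_derive t0 xt; have D2 := pressure_derive2 t0 xt.
have -> : 2 * Y * x * expR (h x - t) =
    (x *: (2 * Y * expR (h x - t)) + derive1 (p ^~ t) x *: 1) -
    derive1 (p ^~ t) x by rewrite /GRing.scale/=; ring.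
by apply: is_deriveB; apply: is_deriveM.
Qed.

(** Since [h z <= t] on the wet region, the second derivative of the pressure is at most [2 * |Y|]
    in absolute value. Hence the slope stays bounded near the inlet and [x] times it tends to 0. *)
Lemma flux_cvg0 {t : R} : 0 < t -> g t x @[x --> 0^'+] --> (-1 : R).
Proof.
move=> t0; have st0 := front_gt0 t0.
have /continuous_within_itvP[]// := pressure_within t0.
rewrite (pressure_inlet sol t0) => _ p0 _.
rewrite -[X in _ --> X]add0r; apply: cvgB => //.
(* [M] is the slope at the midpoint [c] plus the largest change of slope possible on the way to the
   inlet. *)
pose c := s t / 2; pose M := `|derive1 (p ^~ t) c| + `|2 * Y| * c.
have ct : c < s t by rewrite /c; lra.
have c0 : 0 < c by rewrite /c; lra.
have hM x : 0 < x <= c -> `|derive1 (p ^~ t) x| <= M.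
  move=> /andP[x0 xc].
  suff : `|derive1 (p ^~ t) c - derive1 (p ^~ t) x| <= `|2 * Y| * c - `|2 * Y| * x.
    move=> le1.
    have le2 : 0 <= `|2 * Y| * x by rewrite mulr_ge0// ltW.
    have := ler_normB (derive1 (p ^~ t) c) (derive1 (p ^~ t) c - derive1 (p ^~ t) x).
    by rewrite subKr /M; lra.
  pose k x := `|2 * Y| * x.
  apply: (@increment_le _ _ k (fun x => 2 * Y * expR (h x - t)) (fun=> `|2 * Y|)) => //.
  - move=> z /andP[xz zc]; apply: pressure_derive2 => //.
    by rewrite (lt_le_trans x0 xz) (le_lt_trans zc ct).
  - move=> z _; rewrite -[X in is_derive _ _ _ X]mulr1.
    exact: (@is_deriveZ _ _ _ id `|2 * Y| z 1 1 (is_derive_id z 1)).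
  - move=> z /andP[xz zc]; rewrite normrM ler_piMr// ger0_norm ?expR_ge0//.
    by rewrite expR_le1 subr_le0 arrival_le// (lt_trans zc ct).
apply/cvgr0Pnorm_le => e e0.
have M0 : 0 <= M by rewrite addr_ge0// mulr_ge0// ltW.
near=> x.
have x0 : 0 < x by near: x; exact: nbhs_right_gt.
have xc : x <= c by near: x; exact: nbhs_right_ltW.
have xe : x <= e / (M + 1) by near: x; apply: nbhs_right_ltW; rewrite divr_gt0// ltr_wpDl.
rewrite normrM gtr0_norm//.
have := ler_pM (ltW x0) (normr_ge0 _) xe (hM x _).
rewrite x0 xc => /(_ isT)/le_trans; apply.
by rewrite mulrAC ler_pdivrMr ?ltr_wpDl// ler_wpM2l ?(ltW e0)//; lra.
Unshelve. all: by end_near. Qed.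

Lemma flux_front {t : R} : 0 < t ->
  g t x @[x --> (s t)^'-] --> - (2 * phi * s t * derive1 s t).
Proof.
move=> t0; have st0 := front_gt0 t0.
have /continuous_within_itvP[]// := pressure_within t0.
rewrite (pressure_front sol t0) => _ _ p0.
have dp : derive1 (p ^~ t) x @[x --> (s t)^'-] --> - (2 * phi * derive1 s t).
  apply: cvg_trans (cvgN (front_eq sol t0)); apply: near_eq_cvg.
  by apply: nearW => x; rewrite opprfctE opprK.
have -> : - (2 * phi * s t * derive1 s t) =
   s t * (- (2 * phi * derive1 s t)) - 0 by ring.
by apply: cvgB => //; apply: cvgM => //; apply: cvg_at_left_filter; exact: cvg_id.
Qed.

(** The derivative of [expR t * g t] is [2 * Y * z * expR (h z)]. Freezing [expR (h z)] at [expR m]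
    costs at most [expR t - expR m], as [m <= h z <= t] between [x] and [y]. *)
Lemma flux_increment {m t x y : R} : 0 < t -> 0 < x <= y -> y < s t ->
  (forall z, x < z < y -> m <= h z) ->
  `|(expR t * g t y - Y * expR m * y ^+ 2) -
    (expR t * g t x - Y * expR m * x ^+ 2)|
  <= `|Y| * (expR t - expR m) * y ^+ 2 - `|Y| * (expR t - expR m) * x ^+ 2.
Proof.
move=> t0 /andP[x0 xy] yt hm.
pose f z := expR t * g t z - Y * expR m * z ^+ 2.
pose k z := `|Y| * (expR t - expR m) * z ^+ 2.
apply: (@increment_le _ f k
  (fun z => expR t * (2 * Y * z * expR (h z - t)) - Y * expR m * (2 * z))
  (fun z => `|Y| * (expR t - expR m) * (2 * z))) => // z; last 1 first.
- move=> /andP[xz zy].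
  have z0 : 0 < z by rewrite (lt_trans x0 xz).
  have -> : expR t * (2 * Y * z * expR (h z - t)) - Y * expR m * (2 * z) =
      Y * (expR (h z) - expR m) * (2 * z).
    have -> : expR (h z - t) = expR (h z) / expR t by rewrite expRB.
    by field; rewrite gt_eqF// expR_gt0.
  have h1 : expR m <= expR (h z) by rewrite ler_expR hm// xz.
  have h2 : expR (h z) <= expR t by rewrite ler_expR arrival_le// (lt_trans zy yt).
  rewrite !normrM (ger0_norm (_ : 0 <= 2)) ?(gtr0_norm z0) ?ler0n//.
  rewrite ler_wpM2r ?mulr_ge0 ?(ltW z0)// ler_wpM2l// ger0_norm ?subr_ge0//.
  exact: lerB.
- move=> /andP[xz zy].
  have zt : 0 < z < s t by rewrite (lt_le_trans x0 xz) (le_lt_trans zy yt).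
  have Dg := flux_derive t0 zt.
  exact: (is_deriveB (@is_deriveZ _ _ _ (g t) (expR t) z 1 _ Dg)
    (is_derive_scale_sqr (Y * expR m) z)).
- by move=> _; exact: is_derive_scale_sqr.
Qed.

(** * The defect [V] and its evolution in time *)

Let ds (t : R) : R := derive1 s t.

(* [1 - phi * (s ^ 2)'], which equals [2 Y] times the integral over the wet
   region at time [t] of [x * (1 - Gamma x t)]. *)
Let V (t : R) : R := 1 - 2 * phi * s t * ds t.

Lemma flux_cvg_front {t : R} : 0 < t -> g t x @[x --> (s t)^'-] --> V t - 1.
Proof.
move=> t0; have -> : V t - 1 = - (2 * phi * s t * ds t) by rewrite /V; ring.
exact: flux_front.
Qed.

Lemma flux_cvg {t x : R} : 0 < t -> 0 < x < s t -> g t y @[y --> x^'-] --> g t x.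
Proof.
move=> t0 xt; have Dg := flux_derive t0 xt.
apply: cvg_at_left_filter; apply: differentiable_continuous.
by rewrite -derivable1_diffP.
Qed.

(* By the reaction law, [expR t * p_xx x t] does not depend on [t]. *)
Lemma flux_compare {a b x : R} : 0 < a -> a <= b -> 0 < x < s a ->
  expR b * g b x - expR a * g a x = expR a - expR b.
Proof.
move=> a0 ab /andP[x0 xa]; have b0 := lt_le_trans a0 ab.
have sab := front_nondecreasing (ltW a0) ab.
pose F z := expR b * g b z - expR a * g a z.
have Fc : F z @[z --> 0^'+] --> expR b * -1 - expR a * -1.
  apply: cvgB; apply: cvgM; (try exact: cvg_cst); exact: flux_cvg0.
have -> : expR a - expR b = expR b * -1 - expR a * -1 by ring.
rewrite -/(F x); apply: cvg_unique Fc => //.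
apply: cvg_near_cst; near=> z.
have z0 : 0 < z by near: z; exact: nbhs_right_gt.
apply/esym/is_derive0_cst; first by near: z; exact: nbhs_right_ltW.
move=> w /andP[zw wx].
have wa : 0 < w < s a by rewrite (lt_le_trans z0 zw) (le_lt_trans wx xa).
have wb : 0 < w < s b.
  by move: wa => /andP[-> /=] /lt_le_trans; apply.
have D1 := @is_deriveZ _ _ _ (g b) (expR b) w 1 _ (flux_derive b0 wb).
have D2 := @is_deriveZ _ _ _ (g a) (expR a) w 1 _ (flux_derive a0 wa).
apply: (@is_derive_eq _ _ _ F w 1 0 _ (is_deriveB D1 D2)).
rewrite /GRing.scale/= !expRB; field.
by rewrite !gt_eqF// expR_gt0.
Unshelve. all: by end_near. Qed.

(** The limit of [flux_increment] as [y] tends to the front. The limit [V t - 1] stands in for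
    [g t (s t)], because [derive1] at the front would see values of the pressure outside the wet
    region. *)
Lemma flux_increment_front {m t x : R} : 0 < t -> 0 < x < s t ->
  (forall z, x < z < s t -> m <= h z) ->
  `|(expR t * (V t - 1) - Y * expR m * s t ^+ 2) -
    (expR t * g t x - Y * expR m * x ^+ 2)|
  <= `|Y| * (expR t - expR m) * s t ^+ 2 - `|Y| * (expR t - expR m) * x ^+ 2.
Proof.
move=> t0 /andP[x0 xt] hm.
have yc : y @[y --> (s t)^'-] --> s t by apply: cvg_at_left_filter; exact: cvg_id.
have y2c c : c * y ^+ 2 @[y --> (s t)^'-] --> c * s t ^+ 2.
  by apply: cvgM; [exact: cvg_cst|exact: (cvgM yc yc)].
apply: (@ler_cvg_to _ ((s t)^'-) _ _
  (fun y => `|(expR t * g t y - Y * expR m * y ^+ 2) -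
    (expR t * g t x - Y * expR m * x ^+ 2)|)
  (fun y => `|Y| * (expR t - expR m) * y ^+ 2 -
    `|Y| * (expR t - expR m) * x ^+ 2)).
- apply: cvg_norm; apply: cvgB; last exact: cvg_cst.
  apply: cvgB; last exact: y2c.
  by apply: cvgM; [exact: cvg_cst|exact: flux_cvg_front].
- by apply: cvgB; [exact: y2c|exact: cvg_cst].
- near=> y.
  have xy : x < y by near: y; exact: nbhs_left_gt.
  have yt : y < s t by near: y; exact: nbhs_left_lt.
  apply: flux_increment => //; first by rewrite x0 ltW.
  by move=> z /andP[xz zy]; rewrite hm// xz (lt_trans zy yt).
Unshelve. all: by end_near. Qed.

(** Up to [s a], the flux at time [b] is known from the one at time [a] by [flux_compare]. What
    remains is the layer from [s a] to [s b], where [flux_increment_front] applies with [m] equal to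
    [a]. *)
Lemma defect_increment {a b : R} : 0 < a -> a <= b ->
  `|expR b * V b - expR a * V a - Y * expR a * (s b ^+ 2 - s a ^+ 2)|
  <= `|Y| * (expR b - expR a) * (s b ^+ 2 - s a ^+ 2).
Proof.
move=> a0 ab; have b0 := lt_le_trans a0 ab.
have sa0 := front_gt0 a0.
have gbc : expR b * g b x @[x --> (s a)^'-] --> expR a * V a - expR b.
  have -> : expR a * V a - expR b = expR a * (V a - 1) + (expR a - expR b) by ring.
  have : expR a * g a x + (expR a - expR b) @[x --> (s a)^'-] -->
      expR a * (V a - 1) + (expR a - expR b).
    apply: cvgD; last exact: cvg_cst.
    by apply: cvgM; [exact: cvg_cst|exact: flux_cvg_front].
  apply: cvg_trans; apply: near_eq_cvg; near=> x.
  rewrite -(@flux_compare a b x)//; first by ring.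
  apply/andP; split; near: x; [exact: nbhs_left_gt|exact: nbhs_left_lt].
(* If the front has not moved, [s a] is also the front at time [b], and uniqueness of the left limit
   decides. Otherwise [s a] is interior at time [b], where [g b] is continuous. *)
have := front_nondecreasing (ltW a0) ab; rewrite le_eqVlt => /predU1P[sab|sab].
  rewrite -sab subrr !mulr0 subr0 normr_le0.
  have : expR b * (V b - 1) = expR a * V a - expR b.
    apply: cvg_unique gbc => //; rewrite sab.
    by apply: cvgM; [exact: cvg_cst|exact: flux_cvg_front].
  by move=> e; apply/eqP; lra.
have sa : 0 < s a < s b by rewrite sa0.
have gba : expR b * g b (s a) = expR a * V a - expR b.
  apply: cvg_unique gbc => //.
  by apply: cvgM; [exact: cvg_cst|exact: flux_cvg].
have -> : expR b * V b - expR a * V a - Y * expR a * (s b ^+ 2 - s a ^+ 2) =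
    (expR b * (V b - 1) - Y * expR a * s b ^+ 2) -
    (expR b * g b (s a) - Y * expR a * s a ^+ 2) by rewrite gba; ring.
rewrite [leRHS]mulrBr; apply: flux_increment_front => // z /andP[az zb].
exact: le_arrival b0 zb (ltW az).
Unshelve. all: by end_near. Qed.

(** This is [flux_increment_front] with [m = 0], since arrival times are positive, and with [x]
    tending to the inlet. Moving [Y * s t ^+ 2] to the right completes [expR t - 1] to [expR t],
    which then cancels. *)
Lemma defect_le {t : R} : 0 < t -> `|V t| <= `|Y| * s t ^+ 2.
Proof.
move=> t0; have st0 := front_gt0 t0.
have le0 : `|(expR t * (V t - 1) - Y * s t ^+ 2) - (expR t * -1 - Y * 0)|
    <= `|Y| * (expR t - 1) * s t ^+ 2 - `|Y| * (expR t - 1) * 0.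
  have x2c c : c * x ^+ 2 @[x --> (0 : R)^'+] --> c * 0.
    rewrite -[X in _ * X](mulr0 (0 : R)); apply: cvgM; first exact: cvg_cst.
    by apply: cvgM; apply: cvg_at_right_filter; exact: cvg_id.
  apply: (@ler_cvg_to _ (0^'+) _ _
    (fun x => `|(expR t * (V t - 1) - Y * s t ^+ 2) -
      (expR t * g t x - Y * x ^+ 2)|)
    (fun x => `|Y| * (expR t - 1) * s t ^+ 2 - `|Y| * (expR t - 1) * x ^+ 2)).
  - apply: cvg_norm; apply: cvgB; first exact: cvg_cst.
    apply: cvgB; last exact: x2c.
    by apply: cvgM; [exact: cvg_cst|exact: flux_cvg0].
  - by apply: cvgB; [exact: cvg_cst|exact: x2c].
  - near=> x.
    have x0 : 0 < x by near: x; exact: nbhs_right_gt.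
    have xt : x < s t by near: x; exact: nbhs_right_lt.
    have := @flux_increment_front 0 t x t0; rewrite x0 xt expR0 !mulr1; apply => //.
    move=> z /andP[xz zt].
    by have [/ltW] := arrival_wet (lt_trans x0 xz) t0 zt (lexx _).
have et : 0 < expR t := expR_gt0 t.
rewrite -(ler_pM2l et) -[X in X * `|_|](gtr0_norm et) -normrM.
have -> : expR t * V t =
    (expR t * (V t - 1) - Y * s t ^+ 2 - (expR t * -1 - Y * 0)) + Y * s t ^+ 2 by ring.
apply: le_trans (ler_normD _ _) _.
rewrite (normrM Y) (ger0_norm (sqr_ge0 _)).
by apply: le_trans (lerD le0 (lexx _)) _; lra.
Unshelve. all: by end_near. Qed.

Lemma sqr_front_nondecreasing {a b : R} : 0 <= a -> a <= b ->
  s a ^+ 2 <= s b ^+ 2.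
Proof.
move=> a0 ab; have sa := s_ge0 sol a0; have sb := s_ge0 sol (le_trans a0 ab).
by rewrite ler_sqr ?nnegrE// front_nondecreasing.
Qed.

Lemma sqr_front_derive {t : R} : 0 < t ->
  is_derive t 1 (fun r => s r ^+ 2) (2 * s t * ds t).
Proof.
move=> /front_derive D.
apply: (@is_derive_eq _ _ _ (fun r => s r ^+ 2) t 1 _ _ (is_deriveM D D)).
by rewrite /GRing.scale/= /ds; ring.
Qed.

(** By [defect_increment], the error in comparing the increments of [expR * V] and [s ^ 2] is a
    product of increments of [expR] and [s ^ 2], as the squeeze criterion requires. *)
Lemma defect_expR_derive {t : R} : 0 < t ->
  is_derive t 1 (fun r => expR r * V r) (Y * expR t * (2 * s t * ds t)).
Proof.
move=> t0.
(* The factor 2 is needed for [r] before [t]: the estimate is then frozen at [expR r], and replacing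
   it by [expR t] costs a second product of increments. *)
apply: (is_derive_squeeze (C := 2 * `|Y|) (e := expR) (sqr_front_derive t0)).
  exact: continuous_expR.
near=> r; have r0 : 0 < r by near: r; exact: lt_nbhsr.
have [tr|/ltW rt] := leP t r.
  have := defect_increment t0 tr; move=> /le_trans; apply.
  have du : 0 <= s r ^+ 2 - s t ^+ 2.
    by rewrite subr_ge0 sqr_front_nondecreasing// ltW.
  have de : 0 <= expR r - expR t by rewrite subr_ge0 ler_expR.
  rewrite (ger0_norm du) (ger0_norm de).
  have := mulr_ge0 (normr_ge0 Y) (mulr_ge0 du de); lra.
have := defect_increment r0 rt.
have du : 0 <= s t ^+ 2 - s r ^+ 2.
  by rewrite subr_ge0 sqr_front_nondecreasing// ltW.
have de : 0 <= expR t - expR r by rewrite subr_ge0 ler_expR.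
rewrite (distrC (s r ^+ 2)) (distrC (expR r)) (ger0_norm du) (ger0_norm de).
set X := (X in `|X| <= _) => Xle.
have -> : expR r * V r - expR t * V t - Y * expR t * (s r ^+ 2 - s t ^+ 2) =
  Y * (expR t - expR r) * (s t ^+ 2 - s r ^+ 2) - X by rewrite /X; ring.
apply: le_trans (ler_normB _ _) _.
apply: le_trans (lerD (lexx _) Xle) _.
by rewrite !normrM (ger0_norm du) (ger0_norm de); lra.
Unshelve. all: by end_near. Qed.

Lemma defect_derive {t : R} : 0 < t ->
  is_derive t 1 V (Y * (2 * s t * ds t) - V t).
Proof.
move=> t0.
have D := is_deriveM (defect_expR_derive t0) (is_derive_expR_scale (-1) t).
have VE : V = (fun r => expR r * V r) * (fun r => expR (-1 * r)).
  by apply/funext => r; rewrite mulrfctE mulrAC -expRD mulN1r subrr expR0 mul1r.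
rewrite [X in is_derive _ _ X _]VE; apply: is_derive_eq D _.
have -> : expR (-1 * t) = (expR t)^-1 by rewrite mulN1r expRN.
rewrite /GRing.scale/=. field.
by rewrite gt_eqF// expR_gt0.
Qed.

(** * Large times, small times and the limits of the ratio *)

Lemma front_asymptotics : 0 < phi -> 0 < phi + Y ->
  exists M, forall t, 1 <= t -> `|(phi + Y) * s t ^+ 2 - t| <= M.
Proof.
(* Substituting [1 - V] for [phi * (s ^ 2)'] gives [V' = c * (v - V)], with equilibrium [v] and
   decay rate [c]. Both [K] and [L] are then constant. They are compared with time 1, an arbitrary
   positive start, as the equations hold only for positive times. *)
move=> phi0 phiY0; pose v := Y / (phi + Y); pose c := (phi + Y) / phi.
pose K r := (V r - v) * expR (c * r).
pose L r := (phi + Y) * s r ^+ 2 - r - V r.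
have KE t : 1 <= t -> K t = K 1.
  move=> t1; apply: is_derive0_cst => // r /andP[r1 _].
  have r0 : 0 < r by apply: lt_le_trans r1.
  have DV : is_derive r 1 (fun r => V r - v) (Y * (2 * s r * ds r) - V r - 0).
    exact: is_deriveB (defect_derive r0) (is_derive_cst v r 1).
  have D := is_deriveM DV (is_derive_expR_scale c r).
  apply: (@is_derive_eq _ _ _ K r 1 _ _ D).
  rewrite /GRing.scale/= /c /v /V. field.
  by rewrite !gt_eqF.
have LE t : 1 <= t -> L t = L 1.
  move=> t1; apply: is_derive0_cst => // r /andP[r1 _].
  have r0 : 0 < r by apply: lt_le_trans r1.
  have D := is_deriveB (is_deriveB
    (@is_deriveZ _ _ _ _ (phi + Y) r 1 _ (sqr_front_derive r0))
    (is_derive_id r 1)) (defect_derive r0).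
  apply: (@is_derive_eq _ _ _ L r 1 _ _ D).
  by rewrite /GRing.scale/= /V; ring.
exists (`|L 1| + (`|v| + `|K 1|)) => t t1.
have -> : (phi + Y) * s t ^+ 2 - t = L 1 + V t by rewrite -(LE t t1) /L; ring.
apply: le_trans (ler_normD _ _) (lerD (lexx _) _).
have -> : V t = v + K 1 * expR (- (c * t)).
  rewrite -(KE t t1) /K expRN mulfK ?gt_eqF ?expR_gt0//; ring.
apply: le_trans (ler_normD _ _) (lerD (lexx _) _).
rewrite normrM ler_piMr// ger0_norm ?expR_ge0// expR_le1 oppr_le0.
by rewrite mulr_ge0 ?divr_ge0 ?ltW// (lt_le_trans _ t1).
Qed.

Lemma front_cvg0 : s t @[t --> 0^'+] --> (0 : R).
Proof.
have /continuous_within_itvcyP[_] := s_continuous sol.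
by rewrite (s_initial sol).
Qed.

(** The derivative of [phi * s r ^+ 2 - r] is [- V r]. By [defect_le] and monotonicity of the front
    it is bounded by the constant [|Y| * s t ^+ 2] up to time [t]. *)
Lemma front_near0 {t : R} : 0 < t ->
  `|phi * s t ^+ 2 - t| <= `|Y| * s t ^+ 2 * t.
Proof.
move=> t0; pose f r := phi * s r ^+ 2 - r; pose k r := `|Y| * s t ^+ 2 * r.
(* The terms with 0 are the limits of [f a] and [k a] as [a] tends to 0. The estimate is proved on
   [[a, t]] first, because the derivatives are available only at positive times. *)
have -> : phi * s t ^+ 2 - t = f t - (phi * (0 * 0) - 0) by rewrite /f; ring.
have -> : `|Y| * s t ^+ 2 * t = k t - `|Y| * s t ^+ 2 * 0 by rewrite /k; ring.
have idc : r @[r --> (0 : R)^'+] --> (0 : R).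
  by apply: cvg_at_right_filter; exact: cvg_id.
apply: (@ler_cvg_to _ (0^'+) _ _ (fun a => `|f t - f a|) (fun a => k t - k a)).
- apply: cvg_norm; apply: cvgB; first exact: cvg_cst.
  apply: cvgB => //; apply: cvgM; first exact: cvg_cst.
  by apply: cvgM; exact: front_cvg0.
- by apply: cvgB; [exact: cvg_cst|apply: cvgM => //; exact: cvg_cst].
near=> a; have a0 : 0 < a by near: a; exact: nbhs_right_gt.
apply: (@increment_le _ f k (fun r => phi * (2 * s r * ds r) - 1)
  (fun=> `|Y| * s t ^+ 2)).
- by near: a; exact: nbhs_right_ltW.
- move=> r /andP[ar _]; have r0 := lt_le_trans a0 ar.
  exact: (is_deriveB (@is_deriveZ _ _ _ _ phi r 1 _ (sqr_front_derive r0))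
    (is_derive_id r 1)).
- move=> r _; rewrite -[X in is_derive _ _ _ X]mulr1.
  exact: (@is_deriveZ _ _ _ id (`|Y| * s t ^+ 2) r 1 1 (is_derive_id r 1)).
move=> r /andP[ar rt]; have r0 := lt_trans a0 ar.
have -> : phi * (2 * s r * ds r) - 1 = - V r by rewrite /V; ring.
rewrite normrN; apply: le_trans (defect_le r0) _.
by rewrite ler_wpM2l// sqr_front_nondecreasing ?ltW.
Unshelve. all: by end_near. Qed.

(** The ratio is the square root of [1 + (c * s t ^+ 2 - t) / t]. The filter is left general to
    cover both limits, at 0 and at infinity. *)
Lemma ratio_cvg1 (c : R) (F : set_system R) {FF : Filter F} : 0 < c ->
  (\forall t \near F, 0 < t) ->
  (c * s t ^+ 2 - t) / t @[t --> F] --> (0 : R) ->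
  s t / Num.sqrt (t / c) @[t --> F] --> (1 : R).
Proof.
move=> c0 F0 cv.
have cv1 : Num.sqrt ((c * s t ^+ 2 - t) / t + 1) @[t --> F] --> (1 : R).
  rewrite -[X in _ --> X]sqrtr1 -[X in _ --> Num.sqrt X]add0r.
  apply: (@cvg_comp _ _ _ _ Num.sqrt _ _ _ _ (@sqrt_continuous R (0 + 1))).
  by apply: cvgD => //; exact: cvg_cst.
apply: cvg_trans cv1; apply: near_eq_cvg; near=> t.
have t0 : 0 < t by near: t.
have -> : (c * s t ^+ 2 - t) / t + 1 = s t ^+ 2 * (t / c)^-1.
  by field; rewrite !gt_eqF.
rewrite sqrtrM ?sqr_ge0// sqrtr_sqr ger0_norm ?(s_ge0 sol) ?ltW//.
by rewrite sqrtrV// divr_ge0 ?ltW.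
Unshelve. all: by end_near. Qed.

End solution.

Theorem theorem2 (R : realType) (phi Y : R)
    (s : R -> R) (p Gamma : R -> R -> R)
    (sol : is_solution phi Y s p Gamma) :
  (0 < phi ->
     s t / Num.sqrt (t / phi) @[t --> 0^'+] --> (1 : R)) /\
  (0 < phi -> 0 < phi + Y ->
     s t / Num.sqrt (t / (phi + Y)) @[t --> +oo] --> (1 : R)).
Proof.
split=> [phi0|phi0 phiY0].
  apply: (ratio_cvg1 sol) => //; first exact: nbhs_right_gt.
  apply/norm_cvg0P.
  have sc := front_cvg0 sol.
  (* Dividing [front_near0] by [t] leaves [|Y| * s t ^+ 2], which vanishes by continuity of the
     front at time 0. *)
  have := cvgM (cvg_cst `|Y|) (cvgM sc sc); rewrite !mulr0 => uc.
  apply: squeeze_cvgr; [|exact: cvg_cst|exact: uc]; near=> t.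
  have t0 : 0 < t by near: t; exact: nbhs_right_gt.
  rewrite normr_ge0/= -expr2 normrM normfV (gtr0_norm t0) ler_pdivrMr//.
  exact: (front_near0 sol).
have [M sM] := front_asymptotics sol phi0 phiY0.
apply: (ratio_cvg1 sol) => //; first exact: nbhs_pinfty_gt.
apply/cvgr0Pnorm_le => e e0; near=> t.
have t1 : 1 <= t by near: t; apply: nbhs_pinfty_ge.
have t0 : 0 < t by apply: lt_le_trans t1.
rewrite normrM normfV (gtr0_norm t0) ler_pdivrMr//.
(* The deviation is bounded by [M], which is at most [e * t] once [t] reaches [M / e]. *)
apply: le_trans (sM t t1) _; rewrite mulrC -ler_pdivrMr//.
Unshelve. all: by end_near. Qed.
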